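(* For all integers $n\geqslant 1$ and $\ell\geqslant 0$, $$|\mathcal{A}_{n,\ell}|=\sum_{i=0}^{n-1}|\mathcal{E}_{i,\ell+1}|\qquad\text{and}\qquad |\mathcal{A}^s_{n,\ell}|=\sum_{i=0}^{n-1}|\mathcal{E}^d_{i,\ell+1}|.$$
   Context: For $\ell\geqslant 0$, a finite set $A\subset\mathbb{N}=\{1,2,\ldots\}$ is $\ell$-strong Schreier if $A=\emptyset$ or $\min A\geqslant \ell|A|-\ell+1$. A set $A=\{a_1<\cdots<a_n\}\subset\mathbb{N}$ is sparse if $|A|\leqslant 2$, or $|A|\geqslant 3$ and $a_i-a_{i-1}\geqslant a_{i-1}-a_{i-2}$ for $3\leqslant i\leqslant n$; it is strongly sparse if $|A|\leqslant 2$, or $|A|\geqslant 3$ and $a_i-a_{i-1}> a_{i-1}-a_{i-2}$ for $3\leqslant i\leqslant n$. Define $\mathcal{A}_{n,\ell}=\{A\subset\{1,\ldots,n\}: n\in A,\ A \text{ sparse and } \ell\text{-strong Schreier}\}$ and $\mathcal{A}^s_{n,\ell}=\{A\subset\{1,\ldots,n\}: n\in A,\ A \text{ strongly sparse and } \ell\text{-strong Schreier}\}$. $\mathcal{E}_{n,\ell}$ is the set of partitions of $n$ into parts each at least $\ell$, and $\mathcal{E}^d_{n,\ell}$ is the set of partitions of $n$ into distinct parts each at least $\ell$; by convention $|\mathcal{E}_{0,\ell}|=|\mathcal{E}^d_{0,\ell}|=1$. *)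

(* Defs.v *)
From mathcomp Require Import all_boot finmap.

Set Implicit Arguments.
Unset Strict Implicit.
Unset Printing Implicit Defensive.

Local Open Scope fset_scope.
Local Open Scope nat_scope.

(* The increasing enumeration a_1 < ... < a_k of a finite set; note that
   [nth 0 (elems A) i] is a_(i+1). *)
Definition elems (A : {fset nat}) : seq nat := sort leq A.

Definition min_elem (A : {fset nat}) : nat := head 0 (elems A).

(* min A >= l|A| - l + 1; for nonempty A the truncated subtraction is exact. *)
Definition strong_schreier (l : nat) (A : {fset nat}) : bool :=
  (A == fset0) || (l * #|` A| - l + 1 <= min_elem A).

Definition gap (A : {fset nat}) (i : nat) : nat :=
  nth 0 (elems A) i.+1 - nth 0 (elems A) i.

Definition sparse (A : {fset nat}) : bool :=
  (#|` A| <= 2) || [forall i : 'I_(#|` A| - 2), gap A i <= gap A i.+1].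

Definition strongly_sparse (A : {fset nat}) : bool :=
  (#|` A| <= 2) || [forall i : 'I_(#|` A| - 2), gap A i < gap A i.+1].

Definition subsets_to (n : nat) : {fset {fset nat}} :=
  fpowerset [fset k in iota 1 n].

Definition calA (n l : nat) : {fset {fset nat}} :=
  [fset A in subsets_to n | [&& n \in A, sparse A & strong_schreier l A]].

Definition calAs (n l : nat) : {fset {fset nat}} :=
  [fset A in subsets_to n
    | [&& n \in A, strongly_sparse A & strong_schreier l A]].

(* Partitions are nonincreasing sequences of positive integers. *)
Definition is_partition (n : nat) (p : seq nat) : bool :=
  [&& sorted geq p, all (leq 1) p & sumn p == n].

Lemma is_partition_bounds n p :
  is_partition n p -> size p <= n /\ all (fun k => k < n.+1) p.
Proof.
move=> /and3P[_ pos /eqP <-]; split.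
  by elim: p pos => //= a p IH /andP[a1 /IH]; rewrite -add1n; apply: leq_add.
elim: p {pos} => //= a p IH; rewrite ltnS leq_addr /=.
by apply: sub_all IH => k; rewrite !ltnS => /leq_trans; apply; apply: leq_addl.
Qed.

(* By [is_partition_bounds], the finite type [{bseq n of 'I_n.+1}] (sequences
   of length at most n with entries at most n) contains every partition of n. *)
Definition calE (n l : nat) : {set {bseq n of 'I_n.+1}} :=
  [set p : {bseq n of 'I_n.+1} |
    is_partition n (map val p) && all (leq l) (map val p)].

Definition calEd (n l : nat) : {set {bseq n of 'I_n.+1}} :=
  [set p : {bseq n of 'I_n.+1} |
    [&& is_partition n (map val p), uniq (map val p)
      & all (leq l) (map val p)]].

(* Main.v *)
Require Import Defs.
From mathcomp Require Import all_boot finmap.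
From mathcomp Require Import zify.

(** A set [a_1 < ... < a_k = n] is determined by its gaps [d_1, ..., d_(k-1)],
    and it is (strongly) sparse exactly when the gaps are (strictly) increasing.
    Since [a_1 = n - sum d_i], the Schreier condition [a_1 >= l (k - 1) + 1]
    reads [sum (d_i + l) <= n - 1]. So [A] corresponds to the partition with
    parts [d_i + l >= l + 1], whose sum is an arbitrary [i <= n - 1]. *)

Local Open Scope fset_scope.
Local Open Scope nat_scope.

Definition gaps (s : seq nat) : seq nat :=
  if s is a :: t then pairmap (fun x y => y - x) a t else [::].

(** Reversed because gaps increase along [A] while partitions are listed in nonincreasing order. *)
Definition gap_parts (l : nat) (A : {fset nat}) : seq nat :=
  rev (map (addn l) (gaps (elems A))).

Lemma size_gaps s : size (gaps s) = (size s).-1.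
Proof. by case: s => //= a t; rewrite size_pairmap. Qed.

Lemma nth_gaps s i :
  i.+1 < size s -> nth 0 (gaps s) i = nth 0 s i.+1 - nth 0 s i.
Proof. by case: s => //= a t it; rewrite (nth_pairmap 0). Qed.

Lemma gaps_scanl a g : gaps (a :: scanl addn a g) = g.
Proof. by rewrite /= scanlK // => x y; rewrite addKn. Qed.

Lemma scanl_gaps a t :
  path leq a t -> scanl addn a (gaps (a :: t)) = t.
Proof.
elim: t a => //= b t IH a /andP[ab bt].
by rewrite subnKC //; congr cons; apply: IH.
Qed.

Lemma last_scanl_addn a g : last a (scanl addn a g) = a + sumn g.
Proof.
by elim: g a => [|d g IH] a /=; rewrite ?addn0 // IH addnA.
Qed.

Lemma path_ltn_scanl a g :
  path ltn a (scanl addn a g) = all (leq 1) g.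
Proof.
elim: g a => //= d g IH a; rewrite IH; congr andb.
by rewrite -{1}(addn0 a) ltn_add2l.
Qed.

Lemma sumn_map_addn l g : sumn (map (addn l) g) = l * size g + sumn g.
Proof. by elim: g => [|d g IH] /=; rewrite ?muln0 // IH; lia. Qed.

Lemma mem_elems A : elems A =i A.
Proof. by move=> x; rewrite mem_sort. Qed.

Lemma size_elems (A : {fset nat}) : size (elems A) = #|` A|.
Proof. by rewrite size_sort. Qed.

Lemma elems_sorted A : sorted ltn (elems A).
Proof.
rewrite ltn_sorted_uniq_leq sort_uniq fset_uniq /=.
exact: (sort_sorted leq_total).
Qed.

Lemma elems_inj : injective elems.
Proof. by move=> A B e; apply/fsetP => x; rewrite -!mem_elems e. Qed.

Lemma elems_fset_seq s : sorted ltn s -> elems [fset x in s] = s.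
Proof.
move=> ss; apply: (irr_sorted_eq ltn_trans ltnn (elems_sorted _) ss) => x.
by rewrite mem_elems !inE.
Qed.

(** For an increasing enumeration, lying in [1..n] and containing [n] constrains only its two
    ends. *)
Lemma in_subsets_toE n A :
  (A \in subsets_to n) && (n \in A)
    = [&& n \in A, 0 < min_elem A & last 0 (elems A) == n].
Proof.
rewrite /min_elem -mem_elems.
have -> : (A \in subsets_to n) = all (fun x => 0 < x <= n) (elems A).
  rewrite fpowersetE; apply/fsubsetP/allP => sA x.
    rewrite mem_elems => /sA; rewrite !inE mem_iota; lia.
  by rewrite -mem_elems => /sA; rewrite !inE mem_iota; lia.
have := elems_sorted A; case: (elems A) => //= a t at_lt.
rewrite andbC; case nA : (n \in a :: t) => //=.
have a_min : {in t, forall x, a < x}.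
  exact/allP/(order_path_min ltn_trans at_lt).
have le_last : {in a :: t, forall x, x <= last a t}.
  move=> x xt; have : sorted leq (a :: t).
    by apply: sub_path at_lt => ? ?; apply: ltnW.
  case/splitPl: xt => p q <-; rewrite /= cat_path last_cat => /andP[_ pq].
  elim: q (last a p) pq => //= b q IH c /andP[cb /IH]; exact: leq_trans.
apply/andP/andP => [[/andP[a0 an] /allP tn]|[a0 /eqP ln]].
  split=> //; rewrite eqn_leq le_last // andbT.
  by have := mem_last a t; rewrite inE => /predU1P[->//|/tn/andP[]].
split; first by rewrite a0 -ln le_last ?mem_head.
apply/allP => x xt; rewrite (leq_ltn_trans (leq0n a) (a_min x xt)) /= -ln.
by apply: le_last; rewrite inE xt orbT.
Qed.

(** Taking [r] to be [leq] or [ltn] covers sparse and strongly sparse sets at once. With at most two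
    elements there is at most one gap, so sortedness is automatic and the cardinality guard
    disappears. *)
Lemma sorted_gapsE (r : rel nat) (A : {fset nat}) :
  (#|` A| <= 2) || [forall i : 'I_(#|` A| - 2), r (gap A i) (gap A i.+1)]
    = sorted r (gaps (elems A)).
Proof.
apply/idP/(sortedP 0) => [/orP[A2 i|/forallP rA i]|rA].
- by rewrite size_gaps size_elems; lia.
- rewrite size_gaps size_elems => iA.
  have i2 : i < #|` A| - 2 by lia.
  have := rA (Ordinal i2); rewrite /gap /= -!nth_gaps // size_elems; lia.
case: leqP => //= A2; apply/forallP => i.
have i2 : i.+2 < size (elems A) by rewrite size_elems -[i.+2]/(2 + i) -ltn_subRL.
rewrite /gap -!nth_gaps // ?(ltnW i2) //; apply: rA.
by rewrite size_gaps -ltnS prednK // (ltn_trans _ i2).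
Qed.

(** Gaps determine a set up to translation, and the common last element fixes the translation.
    Membership of [n] excludes the empty set, whose gap list is that of a singleton. *)
Lemma gap_parts_inj l n A B :
  n \in A -> n \in B -> last 0 (elems A) = n -> last 0 (elems B) = n ->
  gap_parts l A = gap_parts l B -> A = B.
Proof.
rewrite -!mem_elems => nA nB lA lB /(inv_inj revK)/(inj_map (@addnI l)) eg.
apply: elems_inj; have := elems_sorted A; have := elems_sorted B.
case: (elems A) nA lA eg => // a s _ lA; case: (elems B) nB lB => // b t _ lB eg.
move=> /(sub_path ltnW)/scanl_gaps tE /(sub_path ltnW)/scanl_gaps sE.
have ab : a = b.
  move: lA lB => /=; rewrite -sE -tE !last_scanl_addn eg => <- /eqP.
  by rewrite eqn_add2r => /eqP.
by rewrite -sE -tE eg ab.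
Qed.

Lemma gap_partsP (r : rel nat) n l A :
  (forall k, {mono addn k : x y / r x y}) ->
  A \in [fset A in subsets_to n | [&& n \in A,
     (#|` A| <= 2) || [forall i : 'I_(#|` A| - 2), r (gap A i) (gap A i.+1)]
     & strong_schreier l A]] ->
  [/\ n \in A, last 0 (elems A) = n
    & [&& sorted (fun x y => r y x) (gap_parts l A),
          all (leq l.+1) (gap_parts l A) & sumn (gap_parts l A) < n]].
Proof.
move=> r_mono; rewrite !inE sorted_gapsE => /and4P[An nA rA lA].
have : (A \in subsets_to n) && (n \in A) by rewrite An nA.
rewrite in_subsets_toE => /and3P[_ _ /eqP lastA]; split=> //.
rewrite /gap_parts rev_sorted sorted_map all_rev sumn_rev sumn_map_addn size_gaps.
rewrite (eq_sorted (r_mono l)) rA /=.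
move: lA nA lastA; rewrite /strong_schreier /min_elem -size_elems -mem_elems.
case/orP => [/eqP-> |]; first by rewrite mem_elems inE.
have := elems_sorted A; case: (elems A) => //= a t at_lt la _ lastA.
have tE := @scanl_gaps a t (sub_path ltnW at_lt).
(* With the tail written as partial sums, strict increase says that the gaps are positive, and [n]
   is [a] plus their sum; the Schreier bound on [a] then bounds the sum of the parts. *)
move: at_lt lastA; rewrite -{1 2}tE path_ltn_scanl last_scanl_addn /= => g0 lastA.
by rewrite all_map (sub_all _ g0) /= => [|x /=]; lia.
Qed.

Lemma gap_parts_onto (r : rel nat) n l p :
  (forall k, {mono addn k : x y / r x y}) ->
  sorted (fun x y => r y x) p -> all (leq l.+1) p -> sumn p < n ->
  exists2 A, A \in [fset A in subsets_to n | [&& n \in A,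
     (#|` A| <= 2) || [forall i : 'I_(#|` A| - 2), r (gap A i) (gap A i.+1)]
     & strong_schreier l A]] & p = gap_parts l A.
Proof.
move=> r_mono rp lp pn.
pose g := map (subn^~ l) (rev p).
have gE : map (addn l) g = rev p.
  rewrite -map_comp map_id_in // => x; rewrite mem_rev => /(allP lp) /=; lia.
have g0 : all (leq 1) g.
  by rewrite all_map all_rev; apply: sub_all lp => x /=; lia.
have sg : l * size g + sumn g < n by rewrite -sumn_map_addn gE sumn_rev.
(* This start makes the last element [n]; by [sg] it exceeds [l * size g], which gives both
   positivity and the Schreier bound. *)
pose a := n - sumn g; pose s := a :: scanl addn a g.
have sE : elems [fset x in s] = s.
  by apply: elems_fset_seq; rewrite /= path_ltn_scanl.
have last_s : last 0 s = n by rewrite /= last_scanl_addn /a; lia.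
have size_s : #|` [fset x in s]| = (size g).+1.
  by rewrite -size_elems sE /= size_scanl.
exists [fset x in s]; last by rewrite /gap_parts sE gaps_scanl gE revK.
have nA : n \in [fset x in s].
  by rewrite -mem_elems sE -{1}last_s; apply: mem_last.
rewrite inE /= inE andbA in_subsets_toE sorted_gapsE nA /strong_schreier /min_elem.
rewrite size_s sE last_s eqxx gaps_scanl -(eq_sorted (r_mono l)).
rewrite -sorted_map gE rev_sorted rp /= /a; lia.
Qed.

(** The sets summed here live in types depending on [i]; gathering them in one list of plain
    sequences makes them comparable with the image of [gap_parts]. *)
Lemma partitions_lt_seq (P : pred (seq nat)) n :
  (forall p, P p -> all (leq 1) p) ->
  exists L : seq (seq nat),
    [/\ uniq L, forall p, (p \in L) = P p && (sumn p < n)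
      & size L = \sum_(0 <= i < n)
          #|[set p : {bseq i of 'I_i.+1} |
              P (map val p) && (sumn (map val p) == i)]|].
Proof.
move=> P1; elim: n => [|n [L [uL memL szL]]].
  by exists [::]; split=> // [p|]; rewrite ?ltn0 ?andbF // big_geq.
pose E := [set p : {bseq n of 'I_n.+1} |
             P (map val p) && (sumn (map val p) == n)].
pose M := [seq map val (p : {bseq n of 'I_n.+1}) | p <- enum E].
have memM p : (p \in M) = P p && (sumn p == n).
  apply/mapP/andP => [[q]|[Pp /eqP pn]].
    by rewrite mem_enum inE => /andP[Pq qn] ->.
  have [szp ltp] : size p <= n /\ all (fun k => k < n.+1) p.
    (* [P] need not imply sortedness, so the bounds are taken from the sorted rearrangement, which
       has the same size, entries and sum. *)
    have := @is_partition_bounds n (sort geq p).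
    rewrite /is_partition size_sort !all_sort P1 //; apply.
    have -> : sorted geq (sort geq p) by apply: sort_sorted => x y; apply: leq_total.
    by rewrite -pn (perm_sumn (permEl (perm_sort _ _))) /=.
  have vE : map val (map (@inord n) p) = p.
    by rewrite -map_comp map_id_in // => x /(allP ltp) xn; rewrite /= inordK.
  have szq : size (map (@inord n) p) <= n by rewrite size_map.
  by exists (Bseq szq); rewrite //= mem_enum inE /= vE Pp pn eqxx.
have uM : uniq M.
  by rewrite map_inj_uniq ?enum_uniq // => p q /(inj_map val_inj)/val_inj.
exists (L ++ M); split=> [|p|].
- rewrite cat_uniq uL uM andbT /=; apply/hasPn => p; rewrite memM memL => /andP[_ /eqP->].
  by rewrite ltnn andbF.
- by rewrite mem_cat memL memM -andb_orr ltnS orbC -leq_eqVlt.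
by rewrite size_cat szL size_map -cardE big_nat_recr.
Qed.

(** The images of the sets under [gap_parts] form a duplicate-free list with the same members as the
    list of partitions, so the two lists have equal length. *)
Lemma card_sparse_schreier (r : rel nat) n l :
  (forall k, {mono addn k : x y / r x y}) ->
  #|` [fset A in subsets_to n | [&& n \in A,
     (#|` A| <= 2) || [forall i : 'I_(#|` A| - 2), r (gap A i) (gap A i.+1)]
     & strong_schreier l A]]|
  = \sum_(0 <= i < n) #|[set p : {bseq i of 'I_i.+1} |
      (sorted (fun x y => r y x) (map val p) && all (leq l.+1) (map val p))
      && (sumn (map val p) == i)]|.
Proof.
move=> r_mono; set F := [fset A in _ | _].
pose P p := sorted (fun x y => r y x) p && all (leq l.+1) p.
have P1 p : P p -> all (leq 1) p.
  by case/andP => _; apply: sub_all => x; apply: leq_trans.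
have [L [uL memL <-]] := @partitions_lt_seq P n P1.
rewrite -(size_map (gap_parts l) F); apply/perm_size/uniq_perm => //.
  rewrite map_inj_in_uniq ?fset_uniq // => A B.
  move=> /(gap_partsP _ _ _ _ r_mono)[nA lA _] /(gap_partsP _ _ _ _ r_mono)[nB lB _].
  exact: gap_parts_inj nA nB lA lB.
move=> p; rewrite memL; apply/mapP/andP => [[A /(gap_partsP _ _ _ _ r_mono)[_ _]]|].
  by move=> /and3P[rA lA sA] ->; split=> //; apply/andP.
by move=> [/andP[rp lp] pn]; exact: gap_parts_onto.
Qed.

Theorem theorem1p6 (n l : nat) (hn : 1 <= n) :
  #|` calA n l| = \sum_(0 <= i < n) #|calE i l.+1| /\
  #|` calAs n l| = \sum_(0 <= i < n) #|calEd i l.+1|.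
Proof.
have pos p : all (leq l.+1) p -> all (leq 1) p.
  by apply: sub_all => x; apply: leq_trans.
split.
  rewrite (card_sparse_schreier leq n l (fun k => leq_add2l k)).
  apply: eq_bigr => i _; apply: eq_card => p; rewrite !inE /is_partition.
  case lp : (all (leq l.+1) _); last by rewrite !andbF.
  by rewrite (pos _ lp) !andbT.
rewrite (card_sparse_schreier ltn n l (fun k => ltn_add2l k)).
apply: eq_bigr => i _; apply: eq_card => p; rewrite !inE /is_partition.
case lp : (all (leq l.+1) _); last by rewrite !andbF.
(* Strictly decreasing means nonincreasing with distinct parts. *)
rewrite (pos _ lp) !andbT /= gtn_sorted_uniq_geq.
by rewrite -andbA andbC.
Qed.
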